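(* Let $U=\{u_1,\ldots,u_n\}$ be a finite set. The matrix $\Theta_n=(\Theta_{\pi\sigma})_{\pi,\sigma\in\Pi(U)}$ decategorifies entrywise to $T_n(t)$, that is, $\operatorname{Hilb}(\Theta_{\pi\sigma})=t^{\rho(\pi,\sigma)}$ for all $\pi,\sigma\in\Pi(U)$. Moreover, if $K$ and $H$ are finite graphs with disjoint edge sets which intersect only in the vertex set $U$, then there is an isomorphism of $\mathbb Z^3$-graded $\mathbf k$-vector spaces $$\mathcal N_0(K\cup_U H)\cong\boldsymbol{\mathcal N}_K^{\mathsf T}\,\Theta_n\,\boldsymbol{\mathcal N}_H,$$ where $\boldsymbol{\mathcal N}_K=(\mathcal N_{U,\pi}(K))_{\pi\in\Pi(U)}$ and $\boldsymbol{\mathcal N}_H=(\mathcal N_{U,\sigma}(H))_{\sigma\in\Pi(U)}$, and matrix multiplication means tensor product in each entry followed by direct sum.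
   Context: Graphs are finite and may have loops and multiple edges. $K\cup_U H$ is the graph with vertex set $V(K)\cup V(H)$, where $V(K)\cap V(H)=U$, and edge set $E(K)\sqcup E(H)$. For $S\subseteq E(G)$, $\omega_G(S)$ denotes the number of connected components of the spanning subgraph $(V(G),S)$. $\Pi(U)$ is the set of set partitions of $U$, and $|\pi|$ is the number of blocks of $\pi$. For $S\subseteq E(K)$, $\pi_K(S)\in\Pi(U)$ is the partition in which $u_i,u_j$ are in the same block precisely when they are connected in $(V(K),S)$; $\pi_H$ is defined likewise. For $\pi,\sigma\in\Pi(U)$, $\rho(\pi,\sigma)$ is the number of blocks of the smallest equivalence relation on $U$ containing the equivalence relations represented by both $\pi$ and $\sigma$. The matrix $T_n(t)$ is $(t^{\rho(\pi,\sigma)})_{\pi,\sigma\in\Pi(U)}$. Let $\mathbf k$ be a field. For a finite-dimensional $\mathbb Z^3$-graded $\mathbf k$-vector space $M$, $\operatorname{Hilb}(M)=\sum_{i,j,k}\dim_{\mathbf k}M_{i,j,k}\,t^ix^jy^k$, and the grading shift is $M\{a,b,c\}_{i,j,k}=M_{i-a,j-b,k-c}$; in particular $\mathbf k\{a,b,c\}$ is one-dimensional, concentrated in degree $(a,b,c)$. Tensor products are over $\mathbf k$ with the usual additive grading. Define $$\mathcal N_0(G)=\bigoplus_{S\subseteq E(G)}\mathbf k\{\omega_G(S),|S|,|E(G)|-|S|\},$$ $$\mathcal N_{U,\pi}(K)=\bigoplus_{S\subseteq E(K),\ \pi_K(S)=\pi}\mathbf k\{\omega_K(S)-|\pi|,|S|,|E(K)|-|S|\}$$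 (and likewise for $H$), and $\Theta_{\pi\sigma}=\mathbf k\{\rho(\pi,\sigma),0,0\}$. *)

(* Defs.v *)
From HB Require Import structures.
From mathcomp Require Import all_boot all_order all_algebra.
From mathcomp Require Import finmap.
From mathcomp Require Import mpoly.

Set Implicit Arguments.
Unset Strict Implicit.
Unset Printing Implicit Defensive.

Import GRing.Theory.
Local Open Scope ring_scope.

(* Edges are named objects, so parallel edges are allowed.  The set of endpoints
   of an edge has one element (a loop) or two.  The value of [ends] outside
   [eset] is irrelevant. *)
Record mgraph (T E : finType) := MGraph {
  vset : {set T};
  eset : {set E};
  ends : E -> {set T};
  ends_sub : forall e, e \in eset -> ends e \subset vset;
  ends_card : forall e, e \in eset -> (0 < #|ends e| <= 2)%N
}.

Section Graphs.
Variables T E : finType.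
Implicit Types (G K H : mgraph T E) (S : {set E}) (U : {set T}).

Definition glue_ends K H (e : E) : {set T} :=
  if e \in eset K then ends K e else ends H e.

Lemma glue_ends_sub K H e :
  e \in eset K :|: eset H -> glue_ends K H e \subset vset K :|: vset H.
Proof.
rewrite in_setU /glue_ends; case: ifP => [eK _|_ /= eH].
  exact: subset_trans (ends_sub eK) (subsetUl _ _).
exact: subset_trans (ends_sub eH) (subsetUr _ _).
Qed.

Lemma glue_ends_card K H e :
  e \in eset K :|: eset H -> (0 < #|glue_ends K H e| <= 2)%N.
Proof.
by rewrite in_setU /glue_ends; case: ifP => [eK _|_ /= eH]; apply: ends_card.
Qed.

(* The union of K and H along V(K) :&: V(H); meaningful when the edge sets are
   disjoint. *)
Definition glue K H : mgraph T E :=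
  MGraph (@glue_ends_sub K H) (@glue_ends_card K H).

Definition adj G S : rel T := [rel x y | [exists e in S, ends G e == [set x; y]]].

Definition omega G S : nat := n_comp (adj G S) (vset G).

Definition conn_part U K S : {set {set T}} :=
  equivalence_partition (connect (adj K S)) U.

End Graphs.

Definition Pi (T : finType) (U : {set T}) : finType :=
  {P : {set {set T}} | partition P U}.

Definition blocks (T : finType) (U : {set T}) (p : Pi U) : nat := #|val p|.

Definition same_block (T : finType) (U : {set T}) (p : Pi U) : rel T :=
  [rel x y | y \in pblock (val p) x].

Definition join_rel (T : finType) (U : {set T}) (p s : Pi U) : rel T :=
  connect [rel x y | same_block p x y || same_block s x y].

Definition rho (T : finType) (U : {set T}) (p s : Pi U) : nat :=
  #|equivalence_partition (join_rel p s) U|.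

Section JoinRel.
Variables (T : finType) (U : {set T}).
Implicit Types p s : Pi U.

Lemma same_block_sub p x y : same_block p x y -> (x \in U) && (y \in U).
Proof.
case/and3P: (valP p) => /eqP covP tP _.
rewrite -[same_block _ _ _]/(y \in pblock (val p) x) => yB.
have xc : x \in cover (val p).
  move: (val p) yB => P; rewrite /pblock.
  case: pickP => [B /andP[BP xB] _ | _]; last by rewrite inE.
  by apply/bigcupP; exists B.
have Bp := pblock_mem xc.
by rewrite -covP xc /=; apply/bigcupP; exists (pblock (val p) x).
Qed.

(* On U, [join_rel p s] is the smallest equivalence relation containing the
   ones given by p and s. *)
Lemma join_rel_equiv p s : {in U & &, equivalence_rel (join_rel p s)}.
Proof.
have sb (q : Pi U) (x y : T) : same_block q x y = same_block q y x.
  have tq : trivIset (val q) by case/and3P: (valP q).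
  have h u v : same_block q u v -> same_block q v u.
    move=> uv; have /andP[uU _] := same_block_sub uv.
    have uc : u \in cover (val q) by rewrite (cover_partition (valP q)).
    rewrite -[same_block q v u]/(u \in pblock (val q) v).
    by rewrite (same_pblock tq uv) mem_pblock.
  by apply/idP/idP; apply: h.
have sc : connect_sym [rel x y | same_block p x y || same_block s x y].
  by apply: sym_connect_sym => x y /=; congr (_ || _); apply: sb.
move=> x y z _ _ _; split=> [|xy]; first exact: connect0.
by rewrite /join_rel (same_connect sc xy).
Qed.

Lemma join_relP p s x y :
  x \in U -> y \in U ->
  reflect
    (forall r : rel T, {in U & &, equivalence_rel r} ->
       (forall u v, same_block p u v -> r u v) ->
       (forall u v, same_block s u v -> r u v) -> r x y)
    (join_rel p s x y).
Proof.
move=> xU yU; apply: (iffP idP) => [/connectP[l pl ->] r er rp rs|]; last first.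
  apply; [exact: join_rel_equiv | |] => u v uv; apply: connect1 => /=.
    by apply/orP; left.
  by apply/orP; right.
elim: l x xU pl => [|z l IH] x xU /=; first by move=> _; case: (er x x x).
case/andP=> xz pl.
have /andP[_ zU] : (x \in U) && (z \in U) by case/orP: xz => /same_block_sub.
have rxz : r x z by case/orP: xz => [/rp|/rs].
have lU : last z l \in U.
  elim: l z zU pl {IH xz rxz} => //= w l IH z zU /andP[zw]; apply: IH.
  by case/orP: zw => /same_block_sub /andP[].
by have [_ ->] := er _ _ (last z l) xU zU lU; last exact: rxz; apply: IH.
Qed.

End JoinRel.

Definition deg : choiceType := (int * int * int)%type.

Section Vect.
Import VectorInternalTheory.
Variable k : fieldType.

Definition vzero : vectType k := 'rV[k]_0.

Definition vsum (V W : vectType k) : vectType k := (V * W)%type.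

Lemma dim_vsum (V W : vectType k) : dim (vsum V W) = (dim V + dim W)%N.
Proof. by []. Qed.

(* The tensor product in coordinates; [tens_universal] is its universal
   property. *)
Definition vtens (V W : vectType k) : vectType k := 'M[k]_(dim V, dim W).

Lemma dim_vtens (V W : vectType k) : dim (vtens V W) = (dim V * dim W)%N.
Proof. by []. Qed.

Definition tens (V W : vectType k) (v : V) (w : W) : vtens V W :=
  (v2r v)^T *m v2r w.

Lemma tens_bilinear (V W : vectType k) :
  (forall v : V, linear (fun w : W => tens v w)) /\
  (forall w : W, linear (fun v : V => tens v w)).
Proof.
split=> [v a w w'|w a v v']; rewrite /tens linearP /=.
  by rewrite mulmxDr -scalemxAr.
by rewrite [X in X *m _]linearP /= mulmxDl -scalemxAl.
Qed.

Lemma tens_universal (V W X : vectType k) (f : V -> W -> X) :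
  (forall v, linear (f v)) -> (forall w, linear (f^~ w)) ->
  exists! g : 'Hom(vtens V W, X), forall v w, g (tens v w) = f v w.
Proof.
move=> fr fl.
pose e i : V := r2v (delta_mx 0 i); pose e' j : W := r2v (delta_mx 0 j).
have tE i j : tens (e i) (e' j) = delta_mx i j.
  by rewrite /tens !r2vK trmx_delta mul_delta_mx.
pose g0 (A : vtens V W) : X := \sum_i \sum_j (A : 'M_(_, _)) i j *: f (e i) (e' j).
have g0l : linear g0.
  move=> a A B; rewrite /g0 scaler_sumr -big_split; apply: eq_bigr => i _ /=.
  rewrite scaler_sumr -big_split; apply: eq_bigr => j _ /=.
  by rewrite !mxE scalerDl scalerA.
have flD w u v : f (u + v) w = f u w + f v w.
  by have := fl w 1 u v; rewrite !scale1r.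
have fl0 w : f 0 w = 0.
  by apply: (addrI (f 0 w)); rewrite -flD !addr0.
have flZ w a v : f (a *: v) w = a *: f v w.
  by have := fl w a v 0; rewrite fl0 !addr0.
have frD v u w : f v (u + w) = f v u + f v w.
  by have := fr v 1 u w; rewrite !scale1r.
have fr0 v : f v 0 = 0.
  by apply: (addrI (f v 0)); rewrite -frD !addr0.
have frZ v a w : f v (a *: w) = a *: f v w.
  by have := fr v a w 0; rewrite fr0 !addr0.
have eV v : v = \sum_i v2r v 0 i *: e i.
  apply: v2r_inj; rewrite linear_sum [LHS]row_sum_delta /=.
  by apply: eq_bigr => i _; rewrite linearZ /= r2vK.
have eW w : w = \sum_i v2r w 0 i *: e' i.
  apply: v2r_inj; rewrite linear_sum [LHS]row_sum_delta /=.
  by apply: eq_bigr => i _; rewrite linearZ /= r2vK.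
pose gl := GRing.isLinear.Build _ _ _ _ g0 g0l.
pose gL : {linear vtens V W -> X} := HB.pack g0 gl.
exists (linfun gL); split=> [v w|h hE].
  rewrite lfunE /= /g0 {2}(eV v).
  rewrite (big_morph (f^~ w) (flD w) (fl0 w)); apply: eq_bigr => i _ /=.
  rewrite flZ {2}(eW w) (big_morph (f (e i)) (frD _) (fr0 _)) scaler_sumr.
  apply: eq_bigr => j _; rewrite frZ scalerA; congr (_ *: _).
  by rewrite mxE big_ord1 mxE.
apply/lfunP => A; rewrite lfunE /= /g0.
rewrite [in RHS](matrix_sum_delta (A : 'M_(_, _))) linear_sum.
apply: eq_bigr => i _; rewrite linear_sum; apply: eq_bigr => j _.
by rewrite linearZ /= -tE hE.
Qed.

End Vect.

(* A family of spaces indexed by Z^3, together with a finite set outside of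
   which they vanish; this set need not be the exact support. *)
Record grVect (k : fieldType) := GrVect {
  gcomp :> deg -> vectType k;
  gbound : {fset deg};
  gboundP : forall d, d \notin gbound -> dim (gcomp d) = 0%N
}.

Section Graded.
Variable k : fieldType.
Implicit Types M N : grVect k.

Local Open Scope fset_scope.

Definition giso M N : Prop :=
  exists f : forall d, 'Hom(M d, N d), forall d, bijective (f d).

Lemma gzero_bound (d : deg) : d \notin fset0 -> dim (vzero k) = 0%N.
Proof. by []. Qed.

Definition gzero : grVect k := GrVect gzero_bound.

Lemma gsum_bound M N d :
  d \notin gbound M `|` gbound N -> dim (vsum (M d) (N d)) = 0%N.
Proof.
by rewrite in_fsetU negb_or dim_vsum => /andP[/gboundP -> /gboundP ->].
Qed.

Definition gsum M N : grVect k := GrVect (@gsum_bound M N).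

Definition gtens_comp M N (d : deg) : vectType k :=
  \big[@vsum k/vzero k]_(a <- gbound M) vtens (M a) (N (d - a)).

Lemma gtens_bound M N d :
  d \notin [fset (a + b : deg)%R | a in gbound M, b in gbound N] ->
  dim (gtens_comp M N d) = 0%N.
Proof.
move=> dMN; rewrite /gtens_comp big_seq.
elim/big_ind: _ => [//|V W dV dW|a aM]; first by rewrite dim_vsum dV dW.
rewrite dim_vtens (gboundP (d := d - a)) ?muln0 //; apply: contra dMN => bN.
by apply/imfset2P; exists a => //; exists (d - a); rewrite // addrC subrK.
Qed.

Definition gtens M N : grVect k := GrVect (@gtens_bound M N).

Lemma gunit_bound (d : deg) :
  d \notin [fset (0 : deg)] -> dim ('rV[k]_(d == 0)) = 0%N.
Proof. by rewrite in_fset1 => /negbTE->. Qed.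

(* The row space is of dimension 1 (the field k) when d = 0, and 0 otherwise. *)
Definition gunit : grVect k := GrVect gunit_bound.

Lemma gshift_bound M (s d : deg) :
  d \notin [fset (a + s : deg)%R | a in gbound M] -> dim (M (d - s)) = 0%N.
Proof.
move=> dM; apply: gboundP; apply: contra dM => dM.
by apply/imfsetP; exists (d - s); rewrite // subrK.
Qed.

Definition gshift M (s : deg) : grVect k := GrVect (@gshift_bound M s).

End Graded.

(* Laurent polynomials in t, x, y, inside the fraction field of Z[t, x, y]. *)
Definition hring : fieldType := {fraction {mpoly int[3]}}.
Definition ht : hring := tofrac ('X_0 : {mpoly int[3]}).
Definition hx : hring := tofrac ('X_1 : {mpoly int[3]}).
Definition hy : hring := tofrac ('X_2 : {mpoly int[3]}).

Definition Hilb (k : fieldType) (M : grVect k) : hring :=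
  \sum_(d <- gbound M) (dim (M d))%:R * ht ^ d.1.1 * hx ^ d.1.2 * hy ^ d.2.

Definition Tmat (R : nzSemiRingType) (T : finType) (U : {set T}) (t : R)
    (p s : Pi U) : R :=
  t ^+ rho p s.

Definition gmx (k : fieldType) (I J : finType) := I -> J -> grVect k.

Definition gmx_tr (k : fieldType) (I J : finType) (A : gmx k I J) : gmx k J I :=
  fun j i => A i j.

Definition gmx_mul (k : fieldType) (I J L : finType)
    (A : gmx k I J) (B : gmx k J L) : gmx k I L :=
  fun i l => \big[@gsum k/gzero k]_(j : J) gtens (A i j) (B j l).

Section Categorified.
Variables (k : fieldType) (T : finType).

Definition N0 (E : finType) (G : mgraph T E) : grVect k :=
  \big[@gsum k/gzero k]_(S : {set E} | S \subset eset G)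
    gshift (gunit k)
      ((omega G S)%:Z, #|S|%:Z, #|eset G|%:Z - #|S|%:Z).

Definition NU (E : finType) (U : {set T}) (p : Pi U) (K : mgraph T E) :
    grVect k :=
  \big[@gsum k/gzero k]_(S : {set E} |
      (S \subset eset K) && (conn_part U K S == val p))
    gshift (gunit k)
      ((omega K S)%:Z - (blocks p)%:Z, #|S|%:Z, #|eset K|%:Z - #|S|%:Z).

Definition NUcol (E : finType) (U : {set T}) (K : mgraph T E) :
    gmx k (Pi U) unit :=
  fun p _ => NU p K.

Definition Theta (U : {set T}) : gmx k (Pi U) (Pi U) :=
  fun p s => gshift (gunit k) ((rho p s)%:Z, 0, 0).

End Categorified.

Arguments NUcol k {T E} U K _ _.
Arguments Theta k {T} U _ _.

(* Main.v *)
From HB Require Import structures.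
Require Import Defs.
From mathcomp Require Import all_boot all_order all_algebra.
From mathcomp Require Import finmap zify.

(** Two finite-dimensional graded spaces are isomorphic as soon as they have
    the same dimension in every degree, so everything is a count of degrees.
    The count is organised by the functional [wsum M f], the sum of [f d] over
    the degrees [d] of a homogeneous basis of [M], for an arbitrary weight [f]:
    it is additive on direct sums, it is iterated on tensor products
    ([wsum_gtens]) and it is evaluation on a line ([wsum_line]).  Taking the
    monomial t^i x^j y^k as the weight gives the Hilbert series, hence the
    first claim; taking all weights with values in nat determines the
    isomorphism class ([giso_wsum]).

    For the second claim both sides become sums of values of [f].  A set of
    edges of the glued graph is a union of some S in E(K) and some S' in E(H),
    in a unique way, and grouping the pairs (S, S') by the partitions pi and
    sigma of U that they induce gives the double sum on the right.  It remains
    to match degrees ([N0_deg_glue]).  In x and y this is additivity of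
    cardinals; in t it is
      omega(S u S') = (omega_K(S) - |pi|) + rho(pi, sigma)
                      + (omega_H(S') - |sigma|).
    This holds ([n_comp_union]) because the components of the glued graph are of
    two kinds.  Those that miss U are exactly the components of K or of H that
    miss U: such a component has no vertex at which a path could pass from one
    side to the other ([connect_off]).  There are omega_K(S) - |pi|
    of them on the side of K and omega_H(S') - |sigma| on the side of H.  Those
    that meet U correspond to the classes of connectivity on U, and this
    relation is the join of pi and sigma, since a path between points of U can
    be cut each time it changes side, which happens at a point of U
    ([connect_union]). *)

Set Implicit Arguments.
Unset Strict Implicit.
Unset Printing Implicit Defensive.

Import GRing.Theory.
Local Open Scope ring_scope.

Import VectorInternalTheory.

(** * Graded spaces and weighted dimensions *)

(** In coordinates this is a truncated identity matrix, so it makes sense for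
    all V and W.  An isomorphism built this way needs no proof that the
    dimensions agree, hence can be chosen uniformly over the infinitely many
    degrees. *)
Definition dim_map (k : fieldType) (V W : vectType k) : 'Hom(V, W) :=
  linfun (fun v => r2v (v2r v *m pid_mx (dim V))).

Lemma dim_mapE (k : fieldType) (V W : vectType k) v :
  dim_map V W v = r2v (v2r v *m pid_mx (dim V)).
Proof.
have l : linear (fun v : V => r2v (v2r v *m pid_mx (dim V)) : W).
  by move=> c u w; rewrite !linearP /= mulmxDl -scalemxAl linearP.
pose m := GRing.isLinear.Build _ _ _ _ _ l.
pose f : {linear V -> W} :=
  HB.pack (fun v : V => r2v (v2r v *m pid_mx (dim V)) : W) m.
by rewrite /dim_map -[X in linfun X]/(f : V -> W) lfunE.
Qed.

Lemma dim_mapK (k : fieldType) (V W : vectType k) :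
  dim V = dim W -> cancel (dim_map V W) (dim_map W V).
Proof.
move=> e v; rewrite !dim_mapE r2vK -mulmxA.
have pidK m n : m = n ->
    (pid_mx m : 'M[k]_(m, n)) *m (pid_mx n : 'M_(n, m)) = 1%:M.
  by move=> <-; rewrite pid_mx_1 mulmx1.
by rewrite pidK // mulmx1 v2rK.
Qed.

Lemma giso_dim (k : fieldType) (M N : grVect k) :
  (forall d, dim (M d) = dim (N d)) -> giso M N.
Proof.
move=> e; exists (fun d => dim_map (M d) (N d)) => d.
by exists (dim_map (N d) (M d)); apply: dim_mapK.
Qed.

(** The generalised Hilbert series: a homogeneous basis vector of degree d
    contributes f d. *)
Definition wsum (k : fieldType) (R : nzSemiRingType) (M : grVect k)
    (f : deg -> R) : R :=
  \sum_(d <- gbound M) (dim (M d))%:R * f d.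

(** The bounding set of a graded space is not canonical; this allows two
    spaces to be summed over a common one. *)
Lemma wsum_bound (k : fieldType) (R : nzSemiRingType) (M : grVect k)
    (f : deg -> R) (B : {fset deg}) :
  (gbound M `<=` B)%fset -> wsum M f = \sum_(d <- B) (dim (M d))%:R * f d.
Proof.
move=> sB; apply: (big_fset_incl _ sB) => d _ /gboundP ->.
by rewrite mul0r.
Qed.

Lemma wsum_gsum (k : fieldType) (R : nzSemiRingType) (M N : grVect k)
    (f : deg -> R) : wsum (gsum M N) f = wsum M f + wsum N f.
Proof.
rewrite (wsum_bound f (fsubsetUl (gbound M) (gbound N))).
rewrite (wsum_bound f (fsubsetUr (gbound M) (gbound N))).
by rewrite -big_split; apply: eq_bigr => d _; rewrite dim_vsum natrD mulrDl.
Qed.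

Lemma wsum_big (k : fieldType) (R : nzSemiRingType) (I : finType)
    (P : pred I) (M : I -> grVect k) (f : deg -> R) :
  wsum (\big[@gsum k/gzero k]_(i | P i) M i) f = \sum_(i | P i) wsum (M i) f.
Proof.
apply: (big_morph (fun M => wsum M f)) => [M1 M2|]; first exact: wsum_gsum.
by rewrite /wsum big_seq_fset0.
Qed.

Lemma wsum_line (k : fieldType) (R : nzSemiRingType) (s : deg) (f : deg -> R) :
  wsum (gshift (gunit k) s) f = f s.
Proof.
rewrite (@wsum_bound _ _ _ _ [fset s]%fset).
  by rewrite big_seq_fset1 /= subrr eqxx mul1r.
by apply/fsubsetP => _ /imfsetP[a /= /fset1P-> ->]; rewrite add0r fset11.
Qed.

Lemma dim_wsum (k : fieldType) (M : grVect k) (d : deg) :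
  dim (M d) = wsum M (fun a => (a == d) : nat).
Proof.
have s : (gbound M `<=` d |` gbound M)%fset by exact: fsubsetUr.
rewrite (wsum_bound _ s) (big_fsetD1 d) ?fset1U1 //= eqxx mulr1 natn.
rewrite big_seq big1 ?addr0 // => a.
by rewrite in_fsetD1 => /andP[/negbTE-> _]; rewrite mulr0.
Qed.

Lemma dim_gtens (k : fieldType) (M N : grVect k) (d : deg) :
  dim (gtens M N d) =
  (\sum_(a <- gbound M) dim (M a) * dim (N (d - a)%R))%N.
Proof. exact: (big_morph (fun V : vectType k => dim V)). Qed.

(** For monomial weights this is multiplicativity of the Hilbert series; for
    general weights, degrees of basis vectors add under tensor product. *)
Lemma wsum_gtens (k : fieldType) (R : nzSemiRingType) (M N : grVect k)
    (f : deg -> R) :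
  wsum (gtens M N) f = wsum M (fun a => wsum N (fun b => f (a + b))).
Proof.
rewrite /wsum.
under eq_bigr do rewrite dim_gtens natr_sum mulr_suml.
rewrite exchange_big /= big_seq [RHS]big_seq; apply: eq_bigr => a aM.
under eq_bigr do rewrite natrM -mulrA.
rewrite -mulr_sumr; congr (_ * _).
(* Both sums range over translates of the support of N: substitute
   d = a + b, then enlarge the range to the bounding set of the product. *)
pose g (d : deg) := (dim (N (d - a)))%:R * f d.
have -> : \sum_(b <- gbound N) (dim (N b))%:R * f (a + b) =
          \sum_(d <- [fset (a + b : deg)%R | b in gbound N]%fset) g d.
  rewrite big_imfset /= => [|b c _ _]; last exact: addrI.
  by apply: eq_bigr => b _; rewrite /g (addrC a) addrK.
symmetry; apply: big_fset_incl => [|d _ dN].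
  apply/fsubsetP => _ /imfsetP[b /= bN ->].
  by apply/imfset2P; exists a => //; exists b.
rewrite /g gboundP ?mul0r //; apply: contra dN => dN.
by apply/imfsetP; exists (d - a); rewrite //= addrC subrK.
Qed.

Lemma giso_wsum (k : fieldType) (M N : grVect k) :
  (forall f : deg -> nat, wsum M f = wsum N f) -> giso M N.
Proof. by move=> e; apply: giso_dim => d; rewrite !dim_wsum e. Qed.

Lemma Hilb_wsum (k : fieldType) (M : grVect k) :
  Hilb M = wsum M (fun d => ht ^ d.1.1 * hx ^ d.1.2 * hy ^ d.2).
Proof. by apply: eq_bigr => d _; rewrite !mulrA. Qed.

Local Open Scope nat_scope.

(** * Components meeting and missing a set *)

Lemma eq_in_equivalence_partition (T : finType) (r s : rel T) (D : {set T}) :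
  {in D &, r =2 s} -> equivalence_partition r D = equivalence_partition s D.
Proof.
move=> e; apply: eq_in_imset => x xD; apply/setP => y; rewrite !inE.
by case yD: (y \in D) => //=; apply: e.
Qed.

Lemma connect_equivalence (T : finType) (e : rel T) (D : {set T}) :
  connect_sym e -> {in D & &, equivalence_rel (connect e)}.
Proof.
by move=> se x y z _ _ _; split=> // xy; rewrite (same_connect se xy).
Qed.

Lemma closureP (T : finType) (e : rel T) (D : {set T}) x :
  reflect (exists2 y, y \in D & connect e x y) (x \in closure e D).
Proof.
apply: (iffP existsP) => [[y /andP[xy yD]]|[y yD xy]]; first by exists y.
by exists y; apply/andP.
Qed.

(** Components that meet D correspond to classes of connectivity on D, by
    intersecting a component with D; both sides are counted by their
    representatives [fingraph.root]. *)
Lemma n_comp_closure (T : finType) (e : rel T) (D : {set T}) :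
  connect_sym e ->
  n_comp e (closure e D) = #|equivalence_partition (connect e) D|.
Proof.
move=> se; pose c x := [set y in D | connect e x y].
have cr x y : connect e x y -> c x = c y.
  by move=> xy; apply/setP => z; rewrite !inE (same_connect se xy).
have -> : equivalence_partition (connect e) D =
          c @: predI (roots e) (closure e D).
  apply/setP => B; apply/imsetP/imsetP => -[x xD ->].
    exists (fingraph.root e x); last by apply: cr; apply: connect_root.
    apply/andP; split; first exact: roots_root.
    by apply/closureP; exists x => //; rewrite se connect_root.
  by case/andP: xD => _ /closureP[y yD xy]; exists y => //; apply: cr.
rewrite card_in_imset // => x y /andP[/eqP rx /closureP[z zD xz]].
case/andP=> /eqP ry _ /setP/(_ z); rewrite !inE xz zD /= => /esym yz.
rewrite -rx -ry; apply/(fingraph.rootP se).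
by rewrite (same_connect se xz) se.
Qed.

(** Components are counted by their canonical representatives; for A closed
    under e, these are the ones of the components inside A that miss D. *)
Definition roots_off (T : finType) (e : rel T) (A D : {set T}) : {set T} :=
  [set x in A | roots e x && (x \notin closure e D)].

Lemma n_comp_off (T : finType) (e : rel T) (A D : {set T}) :
  connect_sym e -> closed e A -> D \subset A ->
  n_comp e A = #|equivalence_partition (connect e) D| + #|roots_off e A D|.
Proof.
move=> se cA /subsetP DA; rewrite -(n_comp_closure _ se).
rewrite /n_comp_mem -[LHS](cardID (closure e D)); congr (_ + _).
  apply: eq_card => x; rewrite !inE -andbA; congr (_ && _).
  apply: andb_idl => /closureP[y /DA yA xy].
  by rewrite (closed_connect cA xy).
apply: eq_card => x; rewrite !inE.
by do !case: (_ x) => //; rewrite /= ?andbF ?andbT.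
Qed.

(** * Connectivity in a union of two relations *)

Definition supported (T : finType) (A : {set T}) (a : rel T) :=
  forall x y, a x y -> (x \in A) && (y \in A).

Lemma supported_closed (T : finType) (A : {set T}) (a : rel T) :
  supported A a -> closed a A.
Proof. by move=> sA x y /sA/andP[-> ->]. Qed.

(** A path that starts in a component of [a] missing A :&: B never leaves it: a
    first step along [b] would start at a vertex of B, and that vertex is still in
    A because it was reached along [a]. *)
Lemma connect_off (T : finType) (a b e : rel T) (A B : {set T}) x :
  connect_sym a -> supported A a -> supported B b ->
  (forall u v, e u v = a u v || b u v) ->
  x \in A -> x \notin closure a (A :&: B) ->
  connect e x =1 connect a x.
Proof.
move=> sa sA sB eE xA xU y; apply/idP/idP; last first.
  by apply: connect_sub => u v uv; rewrite connect1 // eE uv.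
case/connectP => l pl ->{y}.
elim/last_ind: l pl => [|l z IH]; first by rewrite connect0.
rewrite rcons_path last_rcons => /andP[/IH xy].
rewrite eE => /orP[yz|/sB/andP[yB _]]; first exact: connect_trans (connect1 yz).
case/closureP: xU; exists (last x l); rewrite // inE yB andbT.
by rewrite -(closed_connect (supported_closed sA) xy).
Qed.

Lemma roots_off_union (T : finType) (a b e : rel T) (A B : {set T}) x :
  connect_sym a -> supported A a -> supported B b ->
  (forall u v, e u v = a u v || b u v) -> x \in A ->
  (x \in roots_off e (A :|: B) (A :&: B)) = (x \in roots_off a A (A :&: B)).
Proof.
move=> sa sA sB eE xA; rewrite !in_set xA /=.
have [xU|xU] := boolP (x \in closure a (A :&: B)).
  suff -> : x \in closure e (A :&: B) by rewrite !andbF.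
  case/closureP: xU => y yU xy; apply/closureP; exists y => //.
  apply: connect_sub xy => u v uv.
  by rewrite connect1 // eE uv.
have c := connect_off sa sA sB eE xA xU.
suff -> : (x \in closure e (A :&: B)) = (x \in closure a (A :&: B)).
  by rewrite /roots /fingraph.root (eq_pick c) (negbTE xU).
by apply/closureP/closureP => -[y yU xy]; exists y; rewrite // ?c // -c.
Qed.

(** A component of the union missing A :&: B lies on one side only, where it is
    a component of that side; none is counted twice, since a vertex in both A
    and B is in A :&: B. *)
Lemma card_roots_off (T : finType) (a b e : rel T) (A B : {set T}) :
  connect_sym a -> connect_sym b -> supported A a -> supported B b ->
  (forall u v, e u v = a u v || b u v) ->
  #|roots_off e (A :|: B) (A :&: B)| =
  #|roots_off a A (A :&: B)| + #|roots_off b B (A :&: B)|.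
Proof.
move=> sa sb sA sB eE; rewrite -cardsUI.
rewrite [X in _ + #|pred_of_set X|](_ : _ = set0) ?cards0 ?addn0.
  apply: eq_card => x; rewrite in_setU.
  have eE' u v : e u v = b u v || a u v by rewrite eE orbC.
  have offS c C y : y \in roots_off c C (A :&: B) -> y \in C.
    by rewrite inE => /andP[].
  have HA := roots_off_union sa sA sB eE.
  have HB := roots_off_union sb sB sA eE'.
  rewrite setUC setIC in HB.
  apply/idP/orP => [xO|[] xO].
  - have := offS _ _ _ xO; rewrite inE => /orP[xA|xB].
      by left; rewrite -HA.
    by right; rewrite -HB.
  - by rewrite HA // (offS _ _ _ xO).
  - by rewrite HB // (offS _ _ _ xO).
apply/setP => x; rewrite !inE; apply/negP => /andP[].
case/and3P => xA _ /negP xU /andP[xB _]; case: xU.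
by apply: mem_closure; rewrite inE xA.
Qed.

(** The equivalence on D induced by connectivity, extended by false outside of
    D; this is [same_block] of the partition that e induces on D. *)
Definition connect_in (T : finType) (D : {set T}) (e : rel T) : rel T :=
  [rel x y | [&& x \in D, y \in D & connect e x y]].

(** Connectivity of the union, restricted to A :&: B, is the join of the
    relations induced by the two sides, because a path can only change side at
    a point of A :&: B. *)
Lemma connect_union (T : finType) (a b e : rel T) (A B : {set T}) :
  supported A a -> supported B b ->
  (forall u v, e u v = a u v || b u v) ->
  {in A :&: B &, connect e =2 connect
     [rel x y | connect_in (A :&: B) a x y || connect_in (A :&: B) b x y]}.
Proof.
move=> sA sB eE u v uU vU; set j := [rel x y | _].
have sub (c : rel T) :
    (forall x y, c x y -> e x y) -> subrel (connect c) (connect e).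
  by move=> ce; apply: connect_sub => x y xy; rewrite connect1 // ce.
have sae : subrel (connect a) (connect e) by apply: sub => x y; rewrite eE => ->.
have sbe : subrel (connect b) (connect e).
  by apply: sub => x y; rewrite eE orbC => ->.
apply/idP/idP; last first.
  by apply: connect_sub => x y /orP[] /and3P[_ _]; [apply: sae|apply: sbe].
have ja x y : x \in A :&: B -> y \in A :&: B -> connect a x y -> connect j x y.
  by move=> xU yU xy; apply: connect1; apply/orP; left; apply/and3P.
have jb x y : x \in A :&: B -> y \in A :&: B -> connect b x y -> connect j x y.
  by move=> xU yU xy; apply: connect1; apply/orP; right; apply/and3P.
(* Invariant along a path from u: y is reached, within a single side, from
   a point w of A :&: B that is already joined to u.  When the path changes
   side at y, this y becomes the new w. *)
pose inv y := exists w, [/\ w \in A :&: B, connect j u w &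
  connect a w y || connect b w y].
suff H y : connect e u y -> inv y.
  by case/H => w [wU uw /orP[] wv]; apply: (connect_trans uw);
    [apply: ja|apply: jb].
case/connectP => l pl ->{y}.
elim/last_ind: l pl => [_|l z IH]; first by exists u; rewrite !connect0.
rewrite rcons_path last_rcons => /andP[/IH[w [wU uw wy]]].
have /setIP[wA wB] := wU; set y := last u l in wy *.
rewrite eE => /orP[yz|yz]; have yz1 := connect1 yz.
  case/orP: wy => wy; first by exists w; rewrite wU uw (connect_trans wy yz1).
  have /andP[yA _] := sA _ _ yz.
  have yU : y \in A :&: B.
    by rewrite inE yA -(closed_connect (supported_closed sB) wy).
  exists y; rewrite yU yz1; split=> //; apply: (connect_trans uw).
  exact: jb.
case/orP: wy => wy; last first.
  by exists w; rewrite wU uw (connect_trans wy yz1) orbT.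
have /andP[yB _] := sB _ _ yz.
have yU : y \in A :&: B.
  by rewrite inE yB -(closed_connect (supported_closed sA) wy) wA.
exists y; rewrite yU yz1 orbT; split=> //; apply: (connect_trans uw).
exact: ja.
Qed.

(** The component count of a union, written without subtraction: the components
    missing A :&: B cancel. *)
Lemma n_comp_union (T : finType) (a b e : rel T) (A B : {set T})
    (part := fun r => equivalence_partition (connect r) (A :&: B)) :
  connect_sym a -> connect_sym b -> supported A a -> supported B b ->
  (forall u v, e u v = a u v || b u v) ->
  n_comp e (A :|: B) + #|part a| + #|part b| =
  n_comp a A + #|part e| + n_comp b B.
Proof.
move=> sa sb sA sB eE.
have se : connect_sym e.
  move=> x y; rewrite !(eq_connect (eE : e =2 relU a b)); exact: relU_sym.
have cE : closed e (A :|: B).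
  move=> x y; rewrite eE => /orP[/sA|/sB] /andP[xC yC];
    by rewrite !inE xC yC ?orbT.
rewrite (n_comp_off (D := A :&: B) se cE); last first.
  exact: subset_trans (subsetIl _ _) (subsetUl _ _).
rewrite (n_comp_off sa (supported_closed sA) (subsetIl A B)).
rewrite (n_comp_off sb (supported_closed sB) (subsetIr A B)).
rewrite (card_roots_off sa sb sA sB eE) /part; lia.
Qed.

(** * Gluing graphs *)

Lemma adj_sym (T E : finType) (G : mgraph T E) (S : {set E}) :
  symmetric (adj G S).
Proof. by move=> x y; apply: eq_existsb => e; rewrite setUC. Qed.

Lemma adj_connect_sym (T E : finType) (G : mgraph T E) (S : {set E}) :
  connect_sym (adj G S).
Proof. exact/sym_connect_sym/adj_sym. Qed.

Lemma adj_supported (T E : finType) (G : mgraph T E) (S : {set E}) :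
  S \subset eset G -> supported (vset G) (adj G S).
Proof.
move=> /subsetP SE x y /existsP[e /andP[/SE/ends_sub sV /eqP eE]].
by move: sV; rewrite eE subUset !sub1set.
Qed.

Lemma adj_glue (T E : finType) (K H : mgraph T E) (S S' : {set E}) :
  [disjoint eset K & eset H] -> S \subset eset K -> S' \subset eset H ->
  forall x y, adj (glue K H) (S :|: S') x y = adj K S x y || adj H S' x y.
Proof.
move=> dKH /subsetP SK /subsetP SH x y.
have gK e : e \in S -> ends (glue K H) e = ends K e.
  by rewrite /= /glue_ends => /SK ->.
have gH e : e \in S' -> ends (glue K H) e = ends H e.
  by rewrite /= /glue_ends => /SH eH; rewrite (disjointFl dKH eH).
apply/existsP/orP => [[e /andP[]]|[] /existsP[e /andP[eS xy]]].
- rewrite inE => /orP[] eS; rewrite ?(gK _ eS) ?(gH _ eS) => xy; [left|right];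
    by apply/existsP; exists e; rewrite eS.
- by exists e; rewrite inE eS gK.
- by exists e; rewrite inE eS gH ?orbT.
Qed.

Lemma conn_part_partition (T E : finType) (U : {set T}) (G : mgraph T E) S :
  partition (conn_part U G S) U.
Proof.
by apply: equivalence_partitionP; apply/connect_equivalence/adj_connect_sym.
Qed.

Definition conn_Pi (T E : finType) (U : {set T}) (G : mgraph T E) S : Pi U :=
  Sub (conn_part U G S) (conn_part_partition U G S).

Lemma same_block_conn (T E : finType) (U : {set T}) (G : mgraph T E) S x y :
  same_block (conn_Pi U G S) x y = connect_in U (adj G S) x y.
Proof.
have eqv := connect_equivalence (D := U) (adj_connect_sym G S).
rewrite /connect_in /=.
have [sb|nsb] := boolP (same_block _ x y).
  have /andP[xU yU] := same_block_sub sb.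
  by rewrite xU yU /= -(pblock_equivalence_partition eqv).
apply/esym/negP => /and3P[xU yU xy]; case/negP: nsb.
by rewrite /same_block /= pblock_equivalence_partition.
Qed.

Lemma omega_glue (T E : finType) (K H : mgraph T E) (S S' : {set E})
    (U := vset K :&: vset H) (p := conn_Pi U K S) (s := conn_Pi U H S') :
  [disjoint eset K & eset H] -> S \subset eset K -> S' \subset eset H ->
  omega (glue K H) (S :|: S') + blocks p + blocks s =
  omega K S + rho p s + omega H S'.
Proof.
move=> dKH SK SH; have eE := adj_glue dKH SK SH.
have sK := adj_supported SK; have sH := adj_supported SH.
have cK := adj_connect_sym K S; have cH := adj_connect_sym H S'.
have rhoE : rho p s = #|conn_part U (glue K H) (S :|: S')|.
  congr #|pred_of_set _|; apply: eq_in_equivalence_partition => x y xU yU.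
  rewrite (connect_union sK sH eE xU yU); apply: eq_connect => u v /=.
  by congr (_ || _); apply: same_block_conn.
by rewrite rhoE; apply: n_comp_union.
Qed.

(** * Comparison of degrees *)

Lemma sum_subsetU (E : finType) (A B : {set E}) (F : {set E} -> nat) :
  [disjoint A & B] ->
  \sum_(X : {set E} | X \subset A :|: B) F X =
  \sum_(S : {set E} | S \subset A) \sum_(S' : {set E} | S' \subset B)
    F (S :|: S').
Proof.
move=> dAB; rewrite pair_big /=.
rewrite (reindex_onto (fun q : {set E} * {set E} => q.1 :|: q.2)
           (fun X => (X :&: A, X :&: B))) /= => [|X XAB].
  apply: eq_bigl => -[S S'] /=; apply/andP/andP => [[_ /eqP[<- <-]]|[SA SB]].
    by rewrite !subsetIr.
  have IA : S' :&: A = set0.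
    by apply/eqP; rewrite setI_eq0 (disjointWl SB) // disjoint_sym.
  have IB : S :&: B = set0.
    by apply/eqP; rewrite setI_eq0 (disjointWl SA).
  rewrite setUSS // !setIUl IA IB setU0 set0U.
  by rewrite (setIidPl SA) (setIidPl SB).
by rewrite -setIUr; apply/setIidPl.
Qed.

Local Open Scope ring_scope.

Definition N0_deg (T E : finType) (G : mgraph T E) (S : {set E}) : deg :=
  ((omega G S)%:Z, #|S|%:Z, #|eset G|%:Z - #|S|%:Z).

Definition NU_deg (T E : finType) (U : {set T}) (p : Pi U) (G : mgraph T E)
    (S : {set E}) : deg :=
  ((omega G S)%:Z - (blocks p)%:Z, #|S|%:Z, #|eset G|%:Z - #|S|%:Z).

(** Each pair (S, S') contributes a line of the same degree to both sides of the
    gluing formula. *)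
Lemma N0_deg_glue (T E : finType) (K H : mgraph T E) (S S' : {set E})
    (U := vset K :&: vset H) (p := conn_Pi U K S) (s := conn_Pi U H S') :
  [disjoint eset K & eset H] -> S \subset eset K -> S' \subset eset H ->
  N0_deg (glue K H) (S :|: S') =
  NU_deg p K S + ((rho p s)%:Z, 0, 0) + NU_deg s H S'.
Proof.
move=> dKH SK SH; have := omega_glue dKH SK SH; rewrite -/U -/p -/s => om.
have cU (A B : {set E}) : A \subset eset K -> B \subset eset H ->
    #|A :|: B| = (#|A| + #|B|)%N.
  move=> AK BH; rewrite cardsU (_ : A :&: B = set0) ?cards0 ?subn0 //.
  by apply/eqP; rewrite setI_eq0 (disjointWl AK) ?(disjointWr BH).
have cE : #|eset K :|: eset H| = (#|eset K| + #|eset H|)%N by apply: cU.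
rewrite /N0_deg /NU_deg /= cE cU //.
have {}om : (omega (glue K H) (S :|: S'))%:Z =
    (omega K S)%:Z - (blocks p)%:Z + (rho p s)%:Z +
    ((omega H S')%:Z - (blocks s)%:Z) by lia.
by congr (_, _, _); rewrite ?om //= ?addr0; lia.
Qed.

Lemma wsum_N0 (k : fieldType) (R : nzSemiRingType) (T E : finType)
    (G : mgraph T E) (f : deg -> R) :
  wsum (N0 k G) f = \sum_(S : {set E} | S \subset eset G) f (N0_deg G S).
Proof. by rewrite wsum_big; apply: eq_bigr => S _; rewrite wsum_line. Qed.

Lemma wsum_NU (k : fieldType) (R : nzSemiRingType) (T E : finType)
    (U : {set T}) (p : Pi U) (G : mgraph T E) (f : deg -> R) :
  wsum (NU k p G) f =
  \sum_(S : {set E} | (S \subset eset G) && (conn_Pi U G S == p))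
    f (NU_deg (conn_Pi U G S) G S).
Proof.
rewrite wsum_big; apply: eq_big => // S /andP[_ /eqP pE].
rewrite wsum_line /NU_deg; congr (f (_ - _%:Z, _, _)).
by rewrite /blocks -pE.
Qed.

Theorem proposition7p1 (k : fieldType) (T : finType) (U : {set T}) :
  (forall p s : Pi U, Hilb (Theta k U p s) = Tmat ht p s) /\
  (forall (E : finType) (K H : mgraph T E),
     [disjoint eset K & eset H] ->
     vset K :&: vset H = U ->
     giso (N0 k (glue K H))
          (gmx_mul (gmx_mul (gmx_tr (NUcol k U K)) (Theta k U))
                   (NUcol k U H) tt tt)).
Proof.
split=> [p s|E K H dKH UE].
  by rewrite Hilb_wsum wsum_line /= !expr0z !mulr1.
subst U; set U := vset K :&: vset H.
apply: giso_wsum => f; rewrite wsum_N0 /= sum_subsetU //.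
rewrite [RHS]wsum_big.
under [RHS]eq_bigr => s _.
  rewrite wsum_gtens wsum_big.
  under eq_bigr => p _.
    rewrite wsum_gtens wsum_NU.
    under eq_bigr => S _ do rewrite wsum_line wsum_NU.
    over.
  over.
(* Each edge set on the left is filed under the partition of U it induces. *)
rewrite [RHS]exchange_big /=.
rewrite (partition_big (conn_Pi U K) xpredT) //=; apply: eq_bigr => p _.
rewrite [RHS]exchange_big /=; apply: eq_bigr => S /andP[SK /eqP pE].
rewrite (partition_big (conn_Pi U H) xpredT) //=; apply: eq_bigr => s _.
apply: eq_bigr => S' /andP[SH /eqP sE].
by rewrite -pE -sE; congr f; apply: N0_deg_glue.
Qed.
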